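(* Let $(M,d)$ be a complete cone metric space over a real Banach space $E$ with cone $P$, where $P$ is a normal cone with normal constant $K$. Let $T: M\to M$ be a continuous and one-to-one mapping and let $S: M\to M$ be a continuous $T$-Zamfirescu mapping. Then: (i) For every $x_0\in M$, $\lim_{n\to\infty} d(TS^nx_0, TS^{n+1}x_0)=0$. (ii) For every $x_0\in M$ there is $y_0\in M$ such that $\lim_{n\to\infty} TS^nx_0=y_0$. (iii) If $T$ is subsequentially convergent, then for every $x_0\in M$ the sequence $(S^nx_0)$ has a convergent subsequence. (iv) There is a unique $z_0\in M$ such that $Sz_0=z_0$. (v) If $T$ is sequentially convergent, then for each $x_0\in M$ the iterate sequence $(S^nx_0)$ converges to $z_0$ (the point in (iv)).
   Context: Let $E$ be a real Banach space. A subset $P\subset E$ is a cone if: $P$ is closed, nonempty and $P\neq\{0\}$; $ax+by\in P$ for all $x,y\in P$ and real $a,b\ge 0$; and $P\cap(-P)=\{0\}$. Throughout, the interior $\operatorname{Int}P$ is assumed nonempty. The partial order on $E$ is $x\le y$ iff $y-x\in P$; $x<y$ means $x\le y$ and $x\ne y$; $x\ll y$ means $y-x\in\operatorname{Int}P$. The cone $P$ is normal if there is $K>0$ such that $0\le x\le y$ implies $\|x\|\le K\|y\|$ for all $x,y\in E$; the least such $K$ is the normal constant of $P$. A cone metric on a nonempty set $M$ is a map $d:M\times M\to E$ such that for all $x,y,z\in M$: $0\le d(x,y)$, and $d(x,y)=0$ iff $x=y$; $d(x,y)=d(y,x)$; $d(x,y)\le d(x,z)+d(z,y)$. Then $(M,d)$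 is a cone metric space. A sequence $(x_n)$ in $M$ converges to $x\in M$ (written $\lim_{n\to\infty}x_n=x$) if for every $c\in E$ with $0\ll c$ there is $n_0$ such that $d(x_n,x)\ll c$ for all $n>n_0$; it is Cauchy if for every $c\in E$ with $0\ll c$ there is $n_0$ such that $d(x_n,x_m)\ll c$ for all $n,m\ge n_0$. $(M,d)$ is complete if every Cauchy sequence in $M$ converges in $M$. Limits of sequences in $E$ are in norm. A mapping $T:M\to M$ is continuous if $\lim_n x_n=x$ implies $\lim_n Tx_n=Tx$ for all sequences $(x_n)$ and points $x$ in $M$. $T$ is subsequentially convergent if for every sequence $(y_n)$ in $M$, whenever $(Ty_n)$ is convergent, $(y_n)$ has a convergent subsequence. $T$ is sequentially convergent if for every sequence $(y_n)$ in $M$, whenever $(Ty_n)$ is convergent, $(y_n)$ is convergent. For mappings $T,S:M\to M$, write $TSx=T(S(x))$, and let $S^n$ be the $n$-th iterate of $S$. $S$ is a $T$-Zamfirescu mapping if there are real numbers $0\le a<1$ and $0\le b,c<1/2$ such that for all $x,y\in M$ at least one of the following holds: (TZ1) $d(TSx,TSy)\le a\,d(Tx,Ty)$; (TZ2) $d(TSx,TSy)\le b[d(Tx,TSx)+d(Ty,TSy)]$; (TZ3) $d(TSx,TSy)\le c[d(Tx,TSy)+d(Ty,TSx)]$.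
   Formalization: In (iv), existence of the fixed point is proved only when T is subsequentially convergent (uniqueness needs no condition); without it (iv) is false: M = E = R, d(x,y) = |x-y|, Tx = exp(-x), Sx = x+1. *)

(* Defs.v *)
From mathcomp Require Export all_boot all_order all_algebra.
From mathcomp Require Export all_classical all_reals all_analysis.
Export numFieldNormedType.Exports.

Set Implicit Arguments.
Unset Strict Implicit.
Unset Printing Implicit Defensive.

Import Order.TTheory GRing.Theory Num.Theory.
Local Open Scope classical_set_scope.
Local Open Scope ring_scope.

Definition is_cone (R : realType) (E : completeNormedModType R) (P : set E) : Prop :=
  [/\ closed P,
      P !=set0,
      P <> [set 0],
      (forall (a b : R) (x y : E),
          0 <= a -> 0 <= b -> P x -> P y -> P (a *: x + b *: y))
    & P `&` [set - x | x in P] = [set 0]].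

Definition cone_le (R : realType) (E : completeNormedModType R) (P : set E)
  (x y : E) : Prop := P (y - x).

Definition cone_ll (R : realType) (E : completeNormedModType R) (P : set E)
  (x y : E) : Prop := P° (y - x).

Definition normal_bound (R : realType) (E : completeNormedModType R) (P : set E)
  (K : R) : Prop :=
  0 < K /\
  forall x y : E, cone_le P 0 x -> cone_le P x y -> `|x| <= K * `|y|.

(* [P] is a normal cone and [K] is the least admissible bound. *)
Definition normal_constant (R : realType) (E : completeNormedModType R)
  (P : set E) (K : R) : Prop :=
  normal_bound P K /\ forall K' : R, normal_bound P K' -> K <= K'.

Section ConeMetric.
Variables (R : realType) (E : completeNormedModType R) (P : set E).
Variables (M : Type) (d : M -> M -> E).

Definition is_cone_metric : Prop :=
  [/\ (forall x y, cone_le P 0 (d x y)),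
      (forall x y, d x y = 0 <-> x = y),
      (forall x y, d x y = d y x)
    & (forall x y z, cone_le P (d x y) (d x z + d z y))].

Definition cone_cvg (u : nat -> M) (x : M) : Prop :=
  forall c : E, cone_ll P 0 c ->
    exists n0 : nat, forall n : nat, (n0 < n)%N -> cone_ll P (d (u n) x) c.

Definition cone_convergent (u : nat -> M) : Prop := exists x, cone_cvg u x.

Definition cone_cauchy (u : nat -> M) : Prop :=
  forall c : E, cone_ll P 0 c ->
    exists n0 : nat, forall n m : nat,
      (n0 <= n)%N -> (n0 <= m)%N -> cone_ll P (d (u n) (u m)) c.

Definition cone_complete : Prop :=
  forall u : nat -> M, cone_cauchy u -> cone_convergent u.

Definition has_convergent_subsequence (u : nat -> M) : Prop :=
  exists phi : nat -> nat,
    {homo phi : m n / (m < n)%N} /\ cone_convergent (fun k => u (phi k)).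

Definition cone_continuous (T : M -> M) : Prop :=
  forall (u : nat -> M) (x : M),
    cone_cvg u x -> cone_cvg (fun n => T (u n)) (T x).

Definition subsequentially_convergent (T : M -> M) : Prop :=
  forall y : nat -> M,
    cone_convergent (fun n => T (y n)) -> has_convergent_subsequence y.

Definition sequentially_convergent (T : M -> M) : Prop :=
  forall y : nat -> M,
    cone_convergent (fun n => T (y n)) -> cone_convergent y.

Definition T_Zamfirescu (T S : M -> M) : Prop :=
  exists a b c : R,
    [/\ 0 <= a < 1, 0 <= b < 1 / 2, 0 <= c < 1 / 2
      & forall x y : M,
        [\/ cone_le P (d (T (S x)) (T (S y))) (a *: d (T x) (T y)),
            cone_le P (d (T (S x)) (T (S y)))
              (b *: (d (T x) (T (S x)) + d (T y) (T (S y))))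
          | cone_le P (d (T (S x)) (T (S y)))
              (c *: (d (T x) (T (S y)) + d (T y) (T (S x))))]].

End ConeMetric.

(* Main.v *)
Require Import Defs.
From mathcomp Require Import all_boot all_order all_algebra.
From mathcomp Require Import all_classical all_reals all_analysis.
From mathcomp Require Import ring lra.

(** Along an orbit [p_n = T (S^n x0)], each of the three Zamfirescu
    alternatives, applied to [S^n x0] and [S^n.+1 x0], bounds the new step
    [e_n.+1 = d p_n.+1 p_n.+2] by a fixed fraction [h < 1] of the old one
    [e_n] ([Zamfirescu_step]): the terms of [e_n.+1] appearing on the right of
    (TZ2) and (TZ3) have coefficient below 1/2 and are absorbed on the left
    ([cone_le_absorb]).  Hence [e_n <= h^n e_0], which tends to 0 in norm by
    normality, and the orbit is Cauchy because [e_n] is dominated by the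
    increments of the null sequence [h^n / (1 - h) e_0] of the cone
    ([cone_cauchy_dominated]).

    Let [y0] be the limit of [p_n].  If some subsequence of [S^n x0]
    converges to [y], then continuity makes [p] converge to [T y] along that
    subsequence and to [T (S y)] along the shifted one.  Both limits are [y0],
    and [T] is one-to-one, so [S y = y] ([orbit_limit_fixed]).  The
    convergence hypotheses on [T] provide such a [y].  Two fixed points
    coincide since the Zamfirescu condition then reads [D <= k D] with [k < 1]
    for the distance [D] of their images by [T], which forces [D = 0]. *)

Import Order.TTheory GRing.Theory Num.Theory.
Local Open Scope classical_set_scope.
Local Open Scope ring_scope.

Set Implicit Arguments.
Unset Strict Implicit.

(** * Order and interior of a cone *)

Section Cone.
Variables (R : realType) (E : completeNormedModType R) (P : set E).
Hypothesis hP : is_cone P.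

Lemma cone_comb (a b : R) (x y : E) :
  0 <= a -> 0 <= b -> P x -> P y -> P (a *: x + b *: y).
Proof. by case: hP => _ _ _ h _; exact: h. Qed.

Lemma cone0 : P 0.
Proof.
case: hP => _ _ _ _ h.
by have [] : (P `&` [set - x | x in P]) 0 by rewrite h.
Qed.

Lemma coneZ (a : R) (x : E) : 0 <= a -> P x -> P (a *: x).
Proof.
move=> a0 Px; rewrite -[a *: x]addr0 -(scale0r x).
exact: cone_comb.
Qed.

Lemma coneD (x y : E) : P x -> P y -> P (x + y).
Proof.
by move=> Px Py; rewrite -[x]scale1r -[y]scale1r; apply: cone_comb.
Qed.

Lemma cone_pointed (x : E) : P x -> P (- x) -> x = 0.
Proof.
case: hP => _ _ _ _ h Px PNx.
suff : (P `&` [set - y | y in P]) x by rewrite h.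
by split => //; exists (- x) => //; rewrite opprK.
Qed.

Lemma cone_le_refl (x : E) : cone_le P x x.
Proof. by rewrite /cone_le subrr; exact: cone0. Qed.

Lemma cone_le_trans (y x z : E) :
  cone_le P x y -> cone_le P y z -> cone_le P x z.
Proof.
rewrite /cone_le => xy yz.
by rewrite -(subrKA y z (- x)); exact: coneD.
Qed.

Lemma cone_leD (x x' y y' : E) :
  cone_le P x x' -> cone_le P y y' -> cone_le P (x + y) (x' + y').
Proof. by rewrite /cone_le opprD addrACA; exact: coneD. Qed.

Lemma cone_leZ (a : R) (x y : E) :
  0 <= a -> cone_le P x y -> cone_le P (a *: x) (a *: y).
Proof. by rewrite /cone_le -scalerBr; exact: coneZ. Qed.

Lemma cone_le_scale (a b : R) (x : E) :
  a <= b -> P x -> cone_le P (a *: x) (b *: x).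
Proof.
by move=> ab; rewrite /cone_le -scalerBl; apply: coneZ; rewrite subr_ge0.
Qed.

Lemma cone_le_contract_eq0 (h : R) (x : E) :
  h < 1 -> P x -> cone_le P x (h *: x) -> x = 0.
Proof.
move=> h1 Px xhx; apply: cone_pointed => //.
have h1' : 1 - h != 0 by rewrite subr_eq0 gt_eqF.
(* [- x] is the multiple [1 / (1 - h)] of [h x - x]. *)
have -> : - x = (1 - h)^-1 *: (h *: x - x).
  have -> : h *: x - x = (h - 1) *: x by rewrite scalerBl scale1r.
  have E1 : (1 - h)^-1 * (h - 1) = -1 by field.
  by rewrite scalerA E1 scaleN1r.
by apply: coneZ => //; rewrite invr_ge0; lra.
Qed.

Lemma cone_le_absorb (b : R) (x y : E) :
  b < 1 -> cone_le P y (b *: (x + y)) -> cone_le P y ((b / (1 - b)) *: x).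
Proof.
rewrite /cone_le => b1 hy.
have b1' : 1 - b != 0 by rewrite subr_eq0 gt_eqF.
have -> : (b / (1 - b)) *: x - y = (1 - b)^-1 *: (b *: (x + y) - y).
  have -> : b *: (x + y) - y = b *: x - (1 - b) *: y.
    by rewrite scalerDr scalerBl scale1r opprB addrA.
  by rewrite scalerBr !scalerA mulVf // scale1r mulrC.
by apply: coneZ => //; rewrite invr_ge0; lra.
Qed.

Lemma interior_coneP (x : E) :
  P° x <-> exists2 e : R, 0 < e & forall y, `|y| < e -> P (x + y).
Proof.
split=> [/nbhs_ballP [e /= e0 xe]|[e e0 xe]].
  exists e => // y ye; apply: xe.
  by rewrite -ball_normE /ball_ /= opprD addNKr normrN.
apply/nbhs_ballP; exists e => //= y.
rewrite -ball_normE /ball_ /= => xye.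
by rewrite -(subrKC x y); apply: xe; rewrite distrC.
Qed.

Lemma interior_coneD (x y : E) : P° x -> P y -> P° (x + y).
Proof.
move=> /interior_coneP [e e0 xe] Py; apply/interior_coneP; exists e => // z ze.
by rewrite addrAC; apply: coneD => //; exact: xe.
Qed.

Lemma interior_coneZ (t : R) (x : E) : 0 < t -> P° x -> P° (t *: x).
Proof.
move=> t0 /interior_coneP [e e0 xe]; apply/interior_coneP.
exists (t * e) => [|z ze]; first exact: mulr_gt0.
have -> : t *: x + z = t *: (x + t^-1 *: z).
  by rewrite scalerDr scalerA divff ?scale1r // gt_eqF.
apply: coneZ; first exact: ltW.
by apply: xe; rewrite normrZ gtr0_norm ?invr_gt0 // mulrC ltr_pdivrMr // mulrC.
Qed.

Lemma cone_llW (x y : E) : cone_ll P x y -> cone_le P x y.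
Proof. exact: interior_subset. Qed.

Lemma cone_le_ll_trans (y x z : E) :
  cone_le P x y -> cone_ll P y z -> cone_ll P x z.
Proof.
rewrite /cone_le /cone_ll => xy yz.
by rewrite -(subrKA y z (- x)); exact: interior_coneD.
Qed.

Lemma cvg0_near_cone_ll (f : nat -> E) (c : E) :
  f @ \oo --> (0 : E) -> cone_ll P 0 c ->
  \forall n \near \oo, cone_ll P (f n) c.
Proof.
rewrite /cone_ll subr0 => f0 Pc.
have cf : (fun n => c - f n) @ \oo --> c.
  rewrite -[X in _ --> X]subr0; apply: cvgB => //; exact: cvg_cst.
apply: cf; apply: open_nbhs_nbhs; split => //; exact: open_interior.
Qed.

(** The cone contains the limit [- x] of [t c - x] as [t] tends to 0, because
    it is closed. *)
Lemma cone_le_small_eq0 (c x : E) :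
  P x -> (forall t : R, 0 < t -> cone_le P x (t *: c)) -> x = 0.
Proof.
move=> Px xc; apply: cone_pointed => //.
have cl : closed P by case: hP.
have lim : (fun n : nat => (n.+1%:R^-1 : R) *: c - x) @ \oo --> - x.
  rewrite -[X in _ --> X]add0r -(scale0r c).
  apply: cvgB; last exact: cvg_cst.
  by apply: cvgZr_tmp; exact: cvg_harmonic.
apply: (closed_cvg P cl _ _ lim).
by apply: nearW => n; apply: xc; rewrite invr_gt0.
Qed.

End Cone.

(** * Sequences in a cone metric space *)

Section ConeMetricSpace.
Variables (R : realType) (E : completeNormedModType R) (P : set E).
Variables (M : Type) (d : M -> M -> E).
Hypotheses (hP : is_cone P) (hd : is_cone_metric P d).

Lemma cone_metric_ge0 (x y : M) : P (d x y).
Proof. by case: hd => h _ _ _; move: (h x y); rewrite /cone_le subr0. Qed.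

Lemma cone_metric_refl (x : M) : d x x = 0.
Proof. by case: hd => _ h _ _; apply/h. Qed.

Lemma cone_metric_eq (x y : M) : d x y = 0 -> x = y.
Proof. by case: hd => _ h _ _ /h. Qed.

Lemma cone_metric_sym (x y : M) : d x y = d y x.
Proof. by case: hd. Qed.

Lemma cone_metric_triangle (z x y : M) : cone_le P (d x y) (d x z + d z y).
Proof. by case: hd. Qed.

Lemma cone_cvg_reindex (u : nat -> M) (x : M) (psi : nat -> nat) :
  (forall k, (k <= psi k)%N) -> cone_cvg P d u x ->
  cone_cvg P d (fun k => u (psi k)) x.
Proof.
move=> hpsi ux c c0; have [n0 hn0] := ux c c0.
by exists n0 => n n0n; apply: hn0; exact: leq_trans (hpsi n).
Qed.

(** Nonemptiness of the interior matters here: with no [c >> 0], every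
    sequence would converge to every point. *)
Lemma cone_cvg_unique (u : nat -> M) (x y : M) :
  P° !=set0 -> cone_cvg P d u x -> cone_cvg P d u y -> x = y.
Proof.
move=> [c Pc] ux uy; apply: cone_metric_eq.
apply: (cone_le_small_eq0 hP (c := c + c)); first exact: cone_metric_ge0.
move=> t t0.
have tc : cone_ll P 0 (t *: c).
  by rewrite /cone_ll subr0; exact: interior_coneZ.
have [n1 h1] := ux _ tc; have [n2 h2] := uy _ tc.
pose n := (maxn n1 n2).+1.
apply: (cone_le_trans hP (cone_metric_triangle (u n) x y)).
rewrite scalerDr; apply: (cone_leD hP).
  rewrite cone_metric_sym; apply: cone_llW; apply: h1.
  by rewrite ltnS leq_maxl.
by apply: cone_llW; apply: h2; rewrite ltnS leq_maxr.
Qed.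

(** The bounds telescope to [d (u n) (u m) <= f n - f m <= f n]. *)
Lemma cone_cauchy_dominated (u : nat -> M) (f : nat -> E) :
  (forall n, P (f n)) -> f @ \oo --> (0 : E) ->
  (forall n, cone_le P (d (u n) (u n.+1)) (f n - f n.+1)) ->
  cone_cauchy P d u.
Proof.
move=> Pf f0 uf c c0.
have uf_add n k : cone_le P (d (u n) (u (n + k)%N)) (f n - f (n + k)%N).
  elim: k => [|k IH].
    by rewrite addn0 cone_metric_refl subrr; exact: (cone_le_refl hP).
  rewrite addnS.
  apply: (cone_le_trans hP (cone_metric_triangle (u (n + k)%N) _ _)).
  rewrite -(subrKA (f (n + k)%N) (f n)); exact: (cone_leD hP).
have uf_le n m : (n <= m)%N -> cone_le P (d (u n) (u m)) (f n).
  move=> nm; rewrite -(subnKC nm); apply: (cone_le_trans hP (uf_add _ _)).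
  by rewrite /cone_le opprB subrKC.
have [N _ hN] := cvg0_near_cone_ll f0 c0.
exists N => n m; wlog nm : n m / (n <= m)%N => [wl|].
  case: (leqP n m) => [|/ltnW] nm Nn Nm; first exact: wl.
  by rewrite cone_metric_sym; exact: wl.
by move=> Nn _; apply: (cone_le_ll_trans hP (uf_le _ _ nm)); exact: hN.
Qed.

Section Contracting.
Variables (u : nat -> M) (h : R).
Hypotheses (h0 : 0 <= h) (h1 : h < 1).
Hypothesis hu :
  forall n, cone_le P (d (u n.+1) (u n.+2)) (h *: d (u n) (u n.+1)).

Lemma contracting_step_le (n : nat) :
  cone_le P (d (u n) (u n.+1)) (h ^+ n *: d (u 0%N) (u 1%N)).
Proof.
elim: n => [|n IH]; first by rewrite expr0 scale1r; exact: (cone_le_refl hP).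
apply: (cone_le_trans hP (hu n)); rewrite exprS -scalerA.
exact: cone_leZ.
Qed.

Lemma cvg_geometric0 (e : E) : (fun n => h ^+ n *: e) @ \oo --> (0 : E).
Proof.
rewrite -(scale0r e); apply: cvgZr_tmp; apply: cvg_expr.
by rewrite ger0_norm.
Qed.

Lemma contracting_cauchy : cone_cauchy P d u.
Proof.
have h1' : 1 - h != 0 by rewrite subr_eq0 gt_eqF.
set e := d (u 0%N) (u 1%N).
apply: (cone_cauchy_dominated (f := fun n => h ^+ n *: ((1 - h)^-1 *: e))).
- move=> n; apply: (coneZ hP); first exact: exprn_ge0.
  apply: (coneZ hP); last exact: cone_metric_ge0.
  by rewrite invr_ge0 subr_ge0 ltW.
- exact: cvg_geometric0.
move=> n; rewrite -scalerBl scalerA.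
have -> : (h ^+ n - h ^+ n.+1) / (1 - h) = h ^+ n.
  by rewrite exprS; field.
exact: contracting_step_le.
Qed.

(** Normality turns domination in the order into domination in norm. *)
Lemma contracting_step_cvg0 (K : R) : normal_bound P K ->
  (fun n => d (u n) (u n.+1)) @ \oo --> (0 : E).
Proof.
move=> [K0 hK]; set e := d (u 0%N) (u 1%N).
apply/cvgr0Pnorm_lt => eps eps0.
have [N _ hN] := cvgr0_norm_lt _ (cvg_geometric0 e) _ (divr_gt0 eps0 K0).
exists N => // n /hN /=; rewrite ltr_pdivlMr // mulrC; apply: le_lt_trans.
apply: hK; last exact: contracting_step_le.
by rewrite /cone_le subr0; exact: cone_metric_ge0.
Qed.

End Contracting.

End ConeMetricSpace.

(** * Zamfirescu mappings *)

Section Zamfirescu.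
Variables (R : realType) (E : completeNormedModType R) (P : set E).
Variables (M : Type) (d : M -> M -> E) (T S : M -> M).
Hypotheses (hP : is_cone P) (hd : is_cone_metric P d).
Hypothesis hTZ : T_Zamfirescu P d T S.

(** (TZ3) reduces to (TZ2) on the pair [x], [S x]: one of its two distances
    vanishes and the triangle inequality splits the other. *)
Lemma Zamfirescu_step : exists2 h : R, 0 <= h < 1 & forall x,
  cone_le P (d (T (S x)) (T (S (S x)))) (h *: d (T x) (T (S x))).
Proof.
have [a [b [c [/andP[a0 a1] /andP[b0 b1] /andP[c0 c1] hS]]]] := hTZ.
have ratio_lt1 (r : R) : r < 1 / 2 -> r / (1 - r) < 1.
  by move=> r1; rewrite ltr_pdivrMr; lra.
exists (Num.max a (Num.max (b / (1 - b)) (c / (1 - c)))).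
  by rewrite le_max a0 /= !gt_max a1 !ratio_lt1.
move=> x; set h := Num.max _ _.
have weaken (r : R) : r <= h ->
    cone_le P (d (T (S x)) (T (S (S x)))) (r *: d (T x) (T (S x))) ->
    cone_le P (d (T (S x)) (T (S (S x)))) (h *: d (T x) (T (S x))).
  move=> rh /(cone_le_trans hP); apply; apply: (cone_le_scale hP rh).
  exact: (cone_metric_ge0 hd).
case: (hS x (S x)) => le_step.
- by apply: weaken le_step; rewrite le_max lexx.
- apply: (weaken (b / (1 - b))); first by rewrite !le_max lexx orbT.
  by apply: (cone_le_absorb hP) => //; lra.
- apply: (weaken (c / (1 - c))); first by rewrite !le_max lexx !orbT.
  apply: (cone_le_absorb hP); first by lra.
  apply: (cone_le_trans hP le_step); apply: (cone_leZ hP c0).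
  by rewrite (cone_metric_refl hd) addr0; exact: (cone_metric_triangle hd).
Qed.

Lemma Zamfirescu_fixed_unique (z z' : M) :
  injective T -> S z = z -> S z' = z' -> z = z'.
Proof.
move=> Tinj Sz Sz'; apply: Tinj; apply: (cone_metric_eq hd).
have [a [b [c [/andP[a0 a1] /andP[b0 b1] /andP[c0 c1] hS]]]] := hTZ.
have D0 := cone_metric_ge0 hd (T z) (T z').
case: (hS z z'); rewrite Sz Sz'.
- exact: (cone_le_contract_eq0 hP).
- rewrite !(cone_metric_refl hd) addr0 scaler0.
  rewrite -[X in cone_le P _ X](scale0r (d (T z) (T z'))).
  exact: (cone_le_contract_eq0 hP).
- rewrite (cone_metric_sym hd (T z') (T z)) -mulr2n -scaler_nat scalerA.
  by apply: cone_le_contract_eq0 => //; lra.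
Qed.

(** The images by [T] of the orbit along [phi] and along its shift [phi + 1]
    are two reindexings of the same convergent sequence [T (S^n x)], so their
    limits [T y] and [T (S y)] agree. *)
Lemma orbit_limit_fixed (phi : nat -> nat) (x y y0 : M) :
  P° !=set0 -> injective T -> cone_continuous P d T -> cone_continuous P d S ->
  cone_cvg P d (fun n => T (iter n S x)) y0 ->
  (forall k, (k <= phi k)%N) -> cone_cvg P d (fun k => iter (phi k) S x) y ->
  S y = y.
Proof.
move=> hInt Tinj Tcont Scont Ty0 hphi Sy; apply: Tinj.
have T1 := Tcont _ _ Sy; have T2 := Tcont _ _ (Scont _ _ Sy).
have <- : y0 = T y.
  exact: (cone_cvg_unique hP hd hInt (cone_cvg_reindex hphi Ty0) T1).
apply: (cone_cvg_unique hP hd hInt T2).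
apply: (cone_cvg_reindex (psi := fun k => (phi k).+1) _ Ty0) => k.
exact: leqW.
Qed.

End Zamfirescu.

Unset Implicit Arguments.
Set Strict Implicit.

Theorem theorem3p2 (R : realType) (E : completeNormedModType R) (P : set E)
    (K : R) (M : Type) (d : M -> M -> E) (T S : M -> M)
    (hP : is_cone P) (hInt : P° !=set0) (hK : normal_constant P K)
    (hM : inhabited M) (hd : is_cone_metric P d) (hcomplete : cone_complete P d)
    (hTcont : cone_continuous P d T) (hTinj : injective T)
    (hScont : cone_continuous P d S) (hTZ : T_Zamfirescu P d T S) :
  [/\ (* (i) *)
      (forall x0 : M,
         (fun n : nat => d (T (iter n S x0)) (T (iter n.+1 S x0))) @ \oo --> (0 : E)),
      (* (ii) *)
      (forall x0 : M, exists y0 : M, cone_cvg P d (fun n => T (iter n S x0)) y0),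
      (* (iii) *)
      (subsequentially_convergent P d T ->
         forall x0 : M, has_convergent_subsequence P d (fun n => iter n S x0)),
      (* (iv) uniqueness without any condition on T; existence under the
         condition of (iii), without which it fails: M = R, T x = exp (- x),
         S x = x + 1 *)
      (forall z z' : M, S z = z -> S z' = z' -> z = z') /\
      (subsequentially_convergent P d T -> exists z0 : M, S z0 = z0)
    & (* (v) *)
      (sequentially_convergent P d T ->
         exists z0 : M, S z0 = z0 /\
           forall x0 : M, cone_cvg P d (fun n => iter n S x0) z0)].
Proof.
have [h /andP[h0 h1] hstep] := Zamfirescu_step hP hd hTZ.
have orbit_step (x0 : M) n := hstep (iter n S x0).
have orbit_cvg (x0 : M) : exists y0, cone_cvg P d (fun n => T (iter n S x0)) y0.
  apply: hcomplete.
  exact: (contracting_cauchy (u := fun n => T (iter n S x0)) hP hd h0 h1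
    (orbit_step x0)).
have fixed_unique (z z' : M) : S z = z -> S z' = z' -> z = z'.
  exact: (Zamfirescu_fixed_unique hP hd hTZ).
split=> //.
- move=> x0; case: hK => hKb _.
  exact: (contracting_step_cvg0 (u := fun n => T (iter n S x0)) hP hd h0 h1
    (orbit_step x0) hKb).
- by move=> hT x0; apply: hT; exact: orbit_cvg.
- split=> // hT; have [x0] := hM; have [y0 Ty0] := orbit_cvg x0.
  have [phi [phi_incr [y Sy]]] := hT (fun n => iter n S x0) (orbit_cvg x0).
  have phi_ge k : (k <= phi k)%N.
    by elim: k => // k IH; apply: leq_ltn_trans IH (phi_incr _ _ (ltnSn k)).
  by exists y; exact: (orbit_limit_fixed hP hd hInt hTinj hTcont hScont Ty0 phi_ge Sy).
- move=> hT.
  have orbit_fixed (x0 : M) :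
      exists2 z, S z = z & cone_cvg P d (fun n => iter n S x0) z.
    have [y0 Ty0] := orbit_cvg x0.
    have [z Sz] := hT (fun n => iter n S x0) (orbit_cvg x0).
    exists z => //.
    exact: (orbit_limit_fixed (phi := id) hP hd hInt hTinj hTcont hScont Ty0
      (fun k => leqnn k) Sz).
  have [x1] := hM; have [z0 Sz0 _] := orbit_fixed x1.
  exists z0; split=> // x0; have [z Sz x0z] := orbit_fixed x0.
  by rewrite (fixed_unique z0 z).
Qed.
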